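(* Let $\mathcal{H}$ be a complex Hilbert space and let $A,B,X,Y\in \mathcal{B}(\mathcal{H})$. Put $$\nu=\frac{c^2(\Re(A))+c^2(\Im(A))}{2}+\left|\frac{\|\Re(A)\|^2-\|\Im(A)\|^2}{2}+\frac{c^2(\Im(A))-c^2(\Re(A))}{2}\right|.$$ Then, for either choice of the sign $\pm$, $$w(AXB\pm BYA)\leq 2\sqrt{2}\,\|B\|\max\left\{\|X\|,\|Y\|\right\}\sqrt{w^2(A)-\nu}.$$
   Context: $\mathcal{B}(\mathcal{H})$ denotes the algebra of all bounded linear operators on the complex Hilbert space $\mathcal{H}$, with operator norm $\|\cdot\|$ and adjoint $A^*$. The numerical radius is $w(A)=\sup\{|\langle Ax,x\rangle| : x\in\mathcal{H},\ \|x\|=1\}$ and the Crawford number is $c(A)=\inf\{|\langle Ax,x\rangle| : x\in\mathcal{H},\ \|x\|=1\}$; $w^2(\cdot)$ and $c^2(\cdot)$ denote their squares. The real and imaginary parts are the operators $\Re(A)=\frac{A+A^*}{2}$ and $\Im(A)=\frac{A-A^*}{2\mathrm{i}}$. *)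

(* Defs.v *)
From HB Require Import structures.
From mathcomp Require Import all_boot all_order all_algebra.
From mathcomp Require Import sesquilinear.
From mathcomp Require Import complex.
From mathcomp Require Import boolp classical_sets reals topology normedtype.

Set Implicit Arguments.
Unset Strict Implicit.
Unset Printing Implicit Defensive.

Import Order.TTheory GRing.Theory Num.Theory.
Import numFieldNormedType.Exports.

Local Open Scope classical_set_scope.
Local Open Scope complex_scope.
Local Open Scope ring_scope.

(* [{dot H for Num.conj}] is linear on the left and conjugate-linear on the
   right. *)
HB.mixin Record isHilbert (R : realType) H of CompleteNormedModule R[i] H := {
  inner : {dot H for Num.conj} ;
  innerxx : forall x : H, inner x x = `|x| ^+ 2 }.

#[short(type="hilbertType")]
HB.structure Definition Hilbert (R : realType) :=
  {H of isHilbert R H & CompleteNormedModule R[i] H}.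

Section operators.
Context {R : realType} {H : hilbertType R}.
Implicit Types A : H -> H.

(* Norms in R[i]-spaces are R[i]-valued; [nrm] is the same number in R. *)
Definition nrm {V : normedModType R[i]} (x : V) : R := complex.Re `|x|.

Definition bounded_op A := exists M : R, forall x, nrm (A x) <= M * nrm x.

Definition opnorm A : R := sup [set nrm (A x) | x in [set x | nrm x <= 1]].

(* When H = 0 there is no unit vector; then both numbers below are 0, because
   [sup set0] and [inf set0] are. *)
Definition numerical_radius A : R :=
  sup [set nrm (inner (A x) x : R[i]^o) | x in [set x | nrm x = 1]].

Definition crawford_number A : R :=
  inf [set nrm (inner (A x) x : R[i]^o) | x in [set x | nrm x = 1]].

(* [adjoint A y] is the vector z with <A x, y> = <x, z> for all x; it is unique,
   and exists when A is linear and bounded by the Riesz theorem. *)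
Definition adjoint A : H -> H :=
  fun y => get [set z | forall x, inner (A x) y = inner x z].

Definition re_op A : H -> H := fun x => 2^-1 *: (A x + adjoint A x).

Definition im_op A : H -> H := fun x => (2 * 'i)^-1 *: (A x - adjoint A x).

End operators.

(* Main.v *)
(* For a unit vector x, |<Ax,x>|^2 = <Re(A)x,x>^2 + <Im(A)x,x>^2, and a
   self-adjoint operator has norm equal to its numerical radius; hence w(A)^2
   dominates both |Re A|^2 + c(Im A)^2 and |Im A|^2 + c(Re A)^2. The larger of
   these two numbers is (|Re A|^2 + |Im A|^2)/2 + nu, so that
   |Re A|^2 + |Im A|^2 <= 2 (w(A)^2 - nu). On the other hand
   |<(AXB +- BYA)x,x>| <= |B| max(|X|,|Y|) (|A^* x| + |Ax|), and
   |Ax|^2 + |A^* x|^2 = 2 (|Re(A)x|^2 + |Im(A)x|^2) by the parallelogram law.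
   The adjoint exists by the Riesz theorem. *)

Require Import Defs.
From mathcomp Require Import all_boot all_order all_algebra.
From mathcomp Require Import sesquilinear complex ring lra.
From mathcomp Require Import boolp classical_sets interval_inference reals.
From mathcomp Require Import topology normedtype.

Import Order.TTheory GRing.Theory Num.Theory.
Import numFieldNormedType.Exports.
Local Open Scope classical_set_scope.
Local Open Scope complex_scope.
Local Open Scope ring_scope.

(** * Real-valued norms on complex normed spaces and on the scalars *)

Section norms.
Context {R : realType} {V : normedModType R[i]}.
Implicit Types (x y : V) (a : R[i]).

Lemma normr_nrm x : `|x| = (nrm x)%:C.
Proof. by rewrite /nrm RRe_real// normr_real. Qed.

Lemma nrm_ge0 x : 0 <= nrm x.
Proof. by rewrite -ler0c -normr_nrm. Qed.

Lemma nrm_eq0 x : (nrm x == 0) = (x == 0).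
Proof. by rewrite -(inj_eq (@complexI R)) -normr_nrm normr_eq0. Qed.

Lemma nrm0 : nrm (0 : V) = 0.
Proof. by apply/eqP; rewrite nrm_eq0. Qed.

Lemma nrmD x y : nrm (x + y) <= nrm x + nrm y.
Proof. by rewrite -lecR rmorphD/= -!normr_nrm ler_normD. Qed.

Lemma nrmB x y : nrm (x - y) <= nrm x + nrm y.
Proof. by rewrite -lecR rmorphD/= -!normr_nrm ler_normB. Qed.

Lemma nrmZ a x : nrm (a *: x) = nrm (a : R[i]^o) * nrm x.
Proof. by apply: complexI; rewrite rmorphM/= -!normr_nrm normrZ. Qed.

End norms.

Section scalars.
Context {R : realType}.

Lemma nrm_real (a : R) : nrm (a%:C : R[i]^o) = `|a|.
Proof. by rewrite /nrm normc_def/= expr0n/= addr0 sqrtr_sqr. Qed.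

Lemma sqr_nrmc (z : R[i]) :
  nrm (z : R[i]^o) ^+ 2 = complex.Re z ^+ 2 + complex.Im z ^+ 2.
Proof. by rewrite /nrm normc_def/= sqr_sqrtr// addr_ge0 ?sqr_ge0. Qed.

Lemma normRe_le (z : R[i]) : `|complex.Re z| <= nrm (z : R[i]^o).
Proof.
rewrite -(@ler_pXn2r _ 2)// ?nnegrE ?nrm_ge0//.
by rewrite sqr_nrmc real_normK ?num_real// lerDl sqr_ge0.
Qed.

End scalars.

(** For [b > 0], evaluate at the minimizer [t = - d / b]. For [b = 0] the expression is affine in
    [t], so it stays nonnegative only if [d = 0]. *)
Lemma quadratic_ge0_discr (F : realFieldType) (a b d : F) :
  0 <= b -> (forall t, 0 <= a + 2 * t * d + t ^+ 2 * b) -> d ^+ 2 <= a * b.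
Proof.
move=> b_ge0 q; have [b0|b_neq0] := eqVneq b 0.
  have [->|d_neq0] := eqVneq d 0; first by rewrite b0 mulr0 expr0n.
  have := q (- (a + 1) / (2 * d)); rewrite b0 mulr0 addr0.
  have -> : a + 2 * (- (a + 1) / (2 * d)) * d = - 1 by field.
  by rewrite oppr_ge0 leNgt ltr01.
have b_gt0 : 0 < b by rewrite lt_def b_neq0.
have := q (- d / b).
have -> : a + 2 * (- d / b) * d + (- d / b) ^+ 2 * b = (a * b - d ^+ 2) / b.
  by field.
by rewrite pmulr_lge0 ?invr_gt0// subr_ge0.
Qed.

(** * The inner product and the Cauchy-Schwarz inequality *)

Section inner.
Context {R : realType} {H : hilbertType R}.
Implicit Types (x y z : H).

(** This is the inner product of the underlying real space. Its values lie in the ordered field [R],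
    where inequalities can be handled directly. *)
Definition dotr x y : R := complex.Re (inner x y).

Lemma innerC x y : inner x y = (inner y x)^*.
Proof. by rewrite hermC mul1r. Qed.

Lemma dotrC x y : dotr x y = dotr y x.
Proof. by rewrite /dotr innerC; case: (inner y x). Qed.

Lemma dotrxx x : dotr x x = nrm x ^+ 2.
Proof. by rewrite /dotr innerxx normr_nrm -rmorphXn. Qed.

Lemma innerDl x y z : inner (x + y) z = inner x z + inner y z.
Proof. exact: (linearDl inner z x y). Qed.

Lemma dotrDl x y z : dotr (x + y) z = dotr x z + dotr y z.
Proof. by rewrite /dotr innerDl; case: (inner x z) (inner y z) => [? ?] []. Qed.

Lemma innerZl (a : R[i]) x y : inner (a *: x) y = a * inner x y.
Proof. exact: (linearZl_LR inner y a x). Qed.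

Lemma dotrNl x z : dotr (- x) z = - dotr x z.
Proof. by rewrite -scaleN1r /dotr innerZl mulN1r; case: (inner x z). Qed.

Lemma dotrBl x y z : dotr (x - y) z = dotr x z - dotr y z.
Proof. by rewrite dotrDl dotrNl. Qed.

Lemma dotrDr x y z : dotr z (x + y) = dotr z x + dotr z y.
Proof. by rewrite !(dotrC z) dotrDl. Qed.

Lemma dotrBr x y z : dotr z (x - y) = dotr z x - dotr z y.
Proof. by rewrite !(dotrC z) dotrBl. Qed.

Lemma dotrZl (a : R) x z : dotr (a%:C *: x) z = a * dotr x z.
Proof.
by rewrite /dotr innerZl; case: (inner x z) => ? ?/=; rewrite mul0r subr0.
Qed.

Lemma dotrZr (a : R) x z : dotr z (a%:C *: x) = a * dotr z x.
Proof. by rewrite !(dotrC z) dotrZl. Qed.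

Lemma sqr_nrmD x y : nrm (x + y) ^+ 2 = nrm x ^+ 2 + 2 * dotr x y + nrm y ^+ 2.
Proof. rewrite -!dotrxx dotrDl !dotrDr (dotrC y x); ring. Qed.

Lemma sqr_nrmB x y : nrm (x - y) ^+ 2 = nrm x ^+ 2 - 2 * dotr x y + nrm y ^+ 2.
Proof. rewrite -!dotrxx dotrBl !dotrBr (dotrC y x); ring. Qed.

Lemma parallelogram x y :
  nrm (x + y) ^+ 2 + nrm (x - y) ^+ 2 = 2 * (nrm x ^+ 2 + nrm y ^+ 2).
Proof. rewrite sqr_nrmD sqr_nrmB; ring. Qed.

(** The square of [nrm (x + t%:C *: y)] is a nonnegative quadratic in [t]. *)
Lemma normr_dotr_le x y : `|dotr x y| <= nrm x * nrm y.
Proof.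
rewrite -(@ler_pXn2r _ 2)// ?nnegrE ?mulr_ge0 ?nrm_ge0// real_normK ?num_real//.
rewrite exprMn; apply: quadratic_ge0_discr => [|t]; first exact: sqr_ge0.
have := sqr_ge0 (nrm (x + t%:C *: y)).
by rewrite sqr_nrmD nrmZ nrm_real dotrZr exprMn real_normK ?num_real// mulrA.
Qed.

(** Replacing [x] by [z^* *: x] turns the inner product into the real number [z^* * z], so the real
    inequality applies; one factor [nrm z] is then cancelled. *)
Lemma normc_inner_le x y : nrm (inner x y : R[i]^o) <= nrm x * nrm y.
Proof.
set z := inner x y; have [->|z0] := eqVneq z 0.
  by rewrite nrm0 mulr_ge0 ?nrm_ge0.
have nz_gt0 : 0 < nrm (z : R[i]^o) by rewrite lt_def nrm_eq0 z0 nrm_ge0.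
rewrite -(ler_pM2l nz_gt0).
have := le_trans (ler_norm _) (normr_dotr_le (z^* *: x) y); rewrite nrmZ.
have -> : nrm (z^* : R[i]^o) = nrm (z : R[i]^o) by rewrite /nrm norm_conjC.
move=> h; rewrite mulrA; apply: le_trans h; rewrite -expr2 sqr_nrmc /dotr innerZl -/z.
by case: z {z0 nz_gt0} => a b /=; rewrite !expr2; lra.
Qed.

End inner.

(** * Riesz representation and existence of the adjoint *)

Section riesz.
Context {R : realType} {H : hilbertType R}.
Implicit Types (x y z h : H).

Lemma cauchy_nrm_cvg (u : nat -> H) :
  (forall n p, nrm (u n - u p) <= n.+1%:R^-1 + p.+1%:R^-1) ->
  exists z, forall e : R, 0 < e -> exists n, n.+1%:R^-1 < e /\ nrm (z - u n) < e.
Proof.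
move=> uC; have near_inv e : 0 < e -> \forall n \near \oo, n.+1%:R^-1 < e :> R.
  by move=> e0; exact: (near_infty_natSinv_lt (PosNum e0)).
have /cvg_ex[z uz] : cvg (u @ \oo).
  apply/cauchy_cvgP/cauchy_ballP => e e0.
  (* Radii of balls live in [R[i]], where being positive forces a zero imaginary part. *)
  have [ec e'0] : e = (complex.Re e)%:C /\ 0 < complex.Re e.
    by move: e0; rewrite ltcE/= => /andP[/eqP i0 r0]; case: e i0 r0 => a b /= ->.
  rewrite near_map2; near=> n p; rewrite -ball_normE /= normr_nrm ec ltcR.
  have -> : complex.Re e = complex.Re e / 2 + complex.Re e / 2 by field.
  apply: le_lt_trans (uC n p) _; apply: ltrD; [near: n|near: p];
    by apply: near_inv; rewrite divr_gt0.
exists z => e e0.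
have : \forall n \near \oo, n.+1%:R^-1 < e /\ nrm (z - u n) < e.
  near=> n; split; first by near: n; exact: near_inv.
  rewrite -ltcR -normr_nrm; near: n.
  by apply: cvgr_dist_lt uz _ _; rewrite ltcR.
by move=> /filter_ex.
Unshelve. all: by end_near.
Qed.

(* Almost minimizing [nrm x ^+ 2 - 2 * g x] to within [e ^+ 2] makes [x]
   represent [g] to within [e]. *)
Lemma almost_riesz (g : H -> R) (M : R) :
  (forall x y, g (x + y) = g x + g y) ->
  (forall (a : R) x, g (a%:C *: x) = a * g x) ->
  (forall x, g x <= M * nrm x) ->
  forall e : R, 0 < e -> exists x, forall h, `|dotr x h - g h| <= e * nrm h.
Proof.
move=> gD gZ gM e e0; pose J x := nrm x ^+ 2 - 2 * g x.
have Jlb : has_inf (range J).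
  split; first by exists (J 0), 0.
  (* Completing the square: [J x] is at least [(nrm x - M) ^+ 2 - M ^+ 2]. *)
  exists (- M ^+ 2) => _ [x _ <-].
  have := sqr_ge0 (nrm x - M); rewrite /J !expr2; have := gM x; nra.
have [_ [x _ <-] xinf] := inf_adherent (exprn_gt0 2 e0) Jlb.
exists x => h; rewrite -(@ler_pXn2r _ 2)// ?nnegrE ?mulr_ge0 ?nrm_ge0 ?(ltW e0)//.
rewrite real_normK ?num_real// exprMn; apply: quadratic_ge0_discr => [|t].
  exact: sqr_ge0.
(* As [J x] exceeds the infimum by less than [e ^+ 2], this makes [e ^+ 2 + 2 * t * (dotr x h - g h)
   + t ^+ 2 * nrm h ^+ 2] nonnegative for every [t]. *)
have : inf (range J) <= J (x + t%:C *: h).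
  by apply: ge_inf; [case: Jlb|exists (x + t%:C *: h)].
rewrite /J sqr_nrmD nrmZ nrm_real gD gZ dotrZr exprMn real_normK ?num_real//.
move: xinf; rewrite /J => xinf Jxt; lra.
Qed.

(** Vectors [u n] representing [g] to within [n.+1%:R^-1] form a Cauchy sequence: testing [u n] and
    [u p] against their own difference bounds its norm by the sum of the two errors. The limit
    represents [g] exactly. *)
Lemma riesz_real (g : H -> R) (M : R) :
  (forall x y, g (x + y) = g x + g y) ->
  (forall (a : R) x, g (a%:C *: x) = a * g x) ->
  (forall x, g x <= M * nrm x) ->
  exists z, forall h, g h = dotr z h.
Proof.
move=> gD gZ gM.
have /choice[u uP] : forall n : nat, exists x, forall h,
    `|dotr x h - g h| <= n.+1%:R^-1 * nrm h.
  by move=> n; apply: almost_riesz gM _ _ => //; rewrite invr_gt0.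
have [|z zu] := @cauchy_nrm_cvg u.
  move=> n p; set h := u n - u p.
  have [->|h0] := eqVneq (nrm h) 0; first by rewrite addr_ge0 ?invr_ge0.
  have h_gt0 : 0 < nrm h by rewrite lt_def h0 nrm_ge0.
  rewrite -(ler_pM2r h_gt0) -expr2 -dotrxx {1}/h dotrBl.
  have -> : dotr (u n) h - dotr (u p) h
    = (dotr (u n) h - g h) - (dotr (u p) h - g h) by ring.
  apply: le_trans (ler_norm _) _; apply: le_trans (ler_normB _ _) _.
  by rewrite mulrDl lerD.
exists z => h; apply/eqP; rewrite eq_sym -subr_eq0 -normr_le0.
apply/ler_addgt0Pr => e e0; rewrite add0r.
have h1 : 0 < nrm h + 1 by rewrite ltr_wpDl// nrm_ge0.
(* Half of [e] goes to each of the two errors; the [+ 1] keeps the denominator positive when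
   [h = 0]. *)
have [|n [ne zn]] := zu (e / (2 * (nrm h + 1))).
  by rewrite divr_gt0// mulr_gt0.
have -> : dotr z h - g h = dotr (z - u n) h + (dotr (u n) h - g h).
  by rewrite dotrBl; ring.
apply: le_trans (ler_normD _ _) _.
apply: le_trans (lerD (normr_dotr_le _ _) (uP n h)) _.
rewrite -mulrDl; apply: (@le_trans _ _ (e / (nrm h + 1) * (nrm h + 1))); last first.
  by rewrite divfK ?gt_eqF.
apply: ler_pM; rewrite ?addr_ge0 ?nrm_ge0 ?invr_ge0// ?lerDl//.
have -> : e / (nrm h + 1) = e / (2 * (nrm h + 1)) + e / (2 * (nrm h + 1)).
  by field; rewrite gt_eqF.
by rewrite ltW// ltrD.
Qed.

Lemma riesz (f : H -> R[i]) (M : R) :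
  (forall x y, f (x + y) = f x + f y) ->
  (forall a x, f (a *: x) = a * f x) ->
  (forall x, nrm (f x : R[i]^o) <= M * nrm x) ->
  exists z, forall x, f x = inner x z.
Proof.
move=> fD fZ fM.
have [|||z zP] := @riesz_real (fun x => complex.Re (f x)) M.
- by move=> x y; rewrite fD; case: (f x) (f y) => [? ?] [].
- by move=> a x; rewrite fZ; case: (f x) => ? ?/=; rewrite mul0r subr0.
- by move=> x; apply: le_trans (fM x); apply: le_trans (normRe_le _); exact: ler_norm.
exists z => x; apply/eqP; rewrite eq_complex; apply/andP; split; apply/eqP.
  by rewrite zP dotrC.
(* The real part at [i x] is minus the imaginary part at [x], so the real functional determines the
   complex one. *)
have := zP (Complex 0 1 *: x); rewrite dotrC /dotr fZ innerZl.
case: (f x) (inner x z) => a b [c d] /=.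
by rewrite !mul0r !mul1r !sub0r => /oppr_inj.
Qed.

(** Riesz applied to the functional sending [x] to [inner (A x) y] shows that the set under [get] is
    inhabited. *)
Lemma adjointP (A : {linear H -> H}) : bounded_op A ->
  forall x y, inner (A x) y = inner x (adjoint A y).
Proof.
move=> [M AM] x y.
apply: (@getPex _ [set z | forall x, inner (A x) y = inner x z]).
have [|||z zP] := @riesz (fun x => inner (A x) y) (M * nrm y); last by exists z.
- by move=> u v; rewrite linearD innerDl.
- by move=> a u; rewrite linearZ innerZl.
- move=> u; apply: le_trans (normc_inner_le _ _) _.
  by rewrite mulrAC ler_wpM2r ?nrm_ge0.
Qed.

End riesz.

(** * Operator norm, numerical radius and Crawford number *)

Section operator_bounds.
Context {R : realType} {H : hilbertType R}.
Implicit Types (T S : H -> H) (x y : H).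

Lemma opnorm_ge0 T : 0 <= opnorm T.
Proof.
have [Tb|Tb] := pselect (has_sup [set nrm (T x) | x in [set x : H | nrm x <= 1]]).
  apply: le_trans (nrm_ge0 (T 0)) _; apply: ub_le_sup; first by case: Tb.
  by exists 0; rewrite //= nrm0.
(* A set without a supremum gets the default value 0. *)
by rewrite /opnorm sup_out.
Qed.

Lemma nrm_le_opnorm T x : bounded_op T -> nrm x <= 1 -> nrm (T x) <= opnorm T.
Proof.
move=> [M TM] x1; apply: ub_le_sup; last by exists x.
(* The constant in [bounded_op] may be negative when [H = 0], hence the absolute value. *)
exists `|M| => _ [y /= y1 <-]; apply: le_trans (TM y) _.
apply: le_trans (_ : `|M| * nrm y <= _); first by rewrite ler_wpM2r ?nrm_ge0 ?ler_norm.
by rewrite ler_piMr.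
Qed.

Lemma opnorm_le T K : 0 <= K -> (forall x, nrm (T x) <= K * nrm x) ->
  opnorm T <= K.
Proof.
move=> K0 TK; apply: ge_sup; first by exists (nrm (T 0)), 0; rewrite //= nrm0.
by move=> _ [x /= x1 <-]; apply: le_trans (TK x) _; rewrite ler_piMr.
Qed.

Lemma nrm_lin_le (T : {linear H -> H}) x : bounded_op T ->
  nrm (T x) <= opnorm T * nrm x.
Proof.
move=> Tb; have [->|x0] := eqVneq x 0.
  by rewrite linear0 !nrm0 mulr0.
have x_gt0 : 0 < nrm x by rewrite lt_def nrm_eq0 x0 nrm_ge0.
have := nrm_le_opnorm T ((nrm x)^-1%:C *: x) Tb.
rewrite linearZ !nrmZ nrm_real ger0_norm ?invr_ge0 ?nrm_ge0//.
rewrite mulVf ?gt_eqF// => /(_ (lexx _)).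
by rewrite mulrC ler_pdivrMr.
Qed.

Lemma numerical_radius_le T K : 0 <= K ->
  (forall x, nrm x = 1 -> nrm (inner (T x) x : R[i]^o) <= K) ->
  numerical_radius T <= K.
Proof.
move=> K0 TK; rewrite /numerical_radius.
(* Without unit vectors the supremum is 0, and [0 <= K] concludes. *)
set E := [set _ | _ in _]; have [->|/set0P E0] := eqVneq E set0.
  by rewrite sup0.
by apply: ge_sup => // _ [x /= x1 <-]; exact: TK.
Qed.

Lemma le_numerical_radius T x : bounded_op T -> nrm x = 1 ->
  nrm (inner (T x) x : R[i]^o) <= numerical_radius T.
Proof.
move=> Tb x1; apply: ub_le_sup; last by exists x.
exists (opnorm T) => _ [y /= y1 <-]; apply: le_trans (normc_inner_le _ _) _.
by rewrite y1 mulr1; apply: nrm_le_opnorm; rewrite ?y1.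
Qed.

Lemma crawford_number_ge0 T : 0 <= crawford_number T.
Proof.
rewrite /crawford_number; set E := [set _ | _ in _].
have [->|/set0P E0] := eqVneq E set0; first by rewrite inf0.
by apply: lb_le_inf => // _ [x _ <-]; exact: nrm_ge0.
Qed.

Lemma crawford_number_le T x : nrm x = 1 ->
  crawford_number T <= nrm (inner (T x) x : R[i]^o).
Proof.
move=> x1; apply: ge_inf; last by exists x.
by exists 0 => _ [y _ <-]; exact: nrm_ge0.
Qed.

(** Polarization writes [4 * dotr (T x) y] as the difference of the quadratic form at [x + y] and at
    [x - y], and the parallelogram law sums the two bounds. Symmetry also expands [T (x + y)], by
    moving [T] to the argument where [dotr] is additive. *)
Lemma symmetric_nrm_le T K : (forall x y, dotr (T x) y = dotr x (T y)) ->
  0 <= K -> (forall x, nrm x = 1 -> `|dotr (T x) x| <= K) ->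
  forall x, nrm (T x) <= K * nrm x.
Proof.
move=> Tsym K0 TK.
have quad x : `|dotr (T x) x| <= K * nrm x ^+ 2.
  have [x0|x0] := eqVneq (nrm x) 0.
    by apply: le_trans (normr_dotr_le _ _) _; rewrite x0 expr0n !mulr0.
  have x_gt0 : 0 < nrm x by rewrite lt_def x0 nrm_ge0.
  have := TK ((nrm x)^-1%:C *: x).
  rewrite nrmZ nrm_real ger0_norm ?invr_ge0 ?nrm_ge0// mulVf// => /(_ erefl).
  rewrite Tsym dotrZl -Tsym dotrZr !normrM normrV ?unitfE// ger0_norm ?nrm_ge0//.
  rewrite mulrA -invfM -expr2 mulrC.
  by rewrite ler_pdivrMr ?exprn_gt0.
have polar x y : 4 * dotr (T x) y <= 2 * K * (nrm x ^+ 2 + nrm y ^+ 2).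
  have := quad (x + y); have := quad (x - y); rewrite !ler_norml.
  rewrite (Tsym (x + y)) (Tsym (x - y)) (dotrBl x y) (dotrDl x y) -!Tsym !dotrBr !dotrDr.
  have -> : dotr (T y) x = dotr (T x) y by rewrite Tsym dotrC.
  have := parallelogram x y.
  move: (nrm (x + y)) (nrm (x - y)) => s d sd /andP[h1 h2] /andP[h3 h4].
  have : K * (s ^+ 2 + d ^+ 2) = K * (2 * (nrm x ^+ 2 + nrm y ^+ 2)) by rewrite sd.
  lra.
(* The polarization bound is used at y = s T x, with |s T x| = |x|. *)
move=> x; have [Tx0|Tx0] := eqVneq (nrm (T x)) 0.
  by rewrite Tx0 mulr_ge0 ?nrm_ge0.
have Tx_gt0 : 0 < nrm (T x) by rewrite lt_def Tx0 nrm_ge0.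
(* By symmetry [nrm (T x) ^+ 2] is [dotr x (T (T x))], which vanishes with [x]. *)
have x_gt0 : 0 < nrm x.
  rewrite lt_def nrm_ge0 andbT; apply: contra_neq Tx0 => x0.
  apply/eqP; rewrite -sqrf_eq0 -dotrxx Tsym -normr_le0.
  by apply: le_trans (normr_dotr_le _ _) _; rewrite x0 mul0r.
have := polar x ((nrm x / nrm (T x))%:C *: T x).
rewrite dotrZr dotrxx nrmZ nrm_real ger0_norm ?divr_ge0 ?nrm_ge0// divfK//.
have -> : nrm x / nrm (T x) * nrm (T x) ^+ 2 = nrm x * nrm (T x) by field.
move=> h; rewrite -(ler_pM2l x_gt0).
rewrite expr2 in h; lra.
Qed.

(** On unit vectors the [T] term is at least [crawford_number T ^+ 2], which leaves at most [K ^+ 2]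
    for the quadratic form of [S]; symmetry turns this into a norm bound. It serves for the real and
    imaginary parts of [A], in both orders. *)
Lemma opnorm_crawford S T W : (forall x y, dotr (S x) y = dotr x (S y)) ->
  (forall x, nrm x = 1 -> nrm (inner (S x) x : R[i]^o) ^+ 2 +
      nrm (inner (T x) x : R[i]^o) ^+ 2 <= W ^+ 2) ->
  bounded_op S /\ opnorm S ^+ 2 + crawford_number T ^+ 2 <= W ^+ 2.
Proof.
move=> Ssym STW; set q := crawford_number T; pose K := Num.sqrt (W ^+ 2 - q ^+ 2).
have q0 : 0 <= q by exact: crawford_number_ge0.
have qx x : nrm x = 1 -> q ^+ 2 <= nrm (inner (T x) x : R[i]^o) ^+ 2.
  by move=> x1; rewrite ler_pXn2r ?nnegrE ?nrm_ge0// crawford_number_le.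
have K0 : 0 <= K by exact: sqrtr_ge0.
(* This makes [K] a genuine square root. Without unit vectors [q] is the infimum of the empty set,
   which is 0. *)
have qW : q ^+ 2 <= W ^+ 2.
  have [[x x1]|nx] := pselect (exists x : H, nrm x = 1).
    apply: le_trans (qx x x1) _; apply: le_trans (STW x x1).
    by rewrite lerDr sqr_ge0.
  suff -> : q = 0 by rewrite expr0n sqr_ge0.
  rewrite /q /crawford_number [X in inf X](_ : _ = set0) ?inf0//.
  by apply/seteqP; split => [t [x x1 _]|//]; apply: nx; exists x.
have SK : forall x, nrm (S x) <= K * nrm x.
  apply: symmetric_nrm_le => // x x1; apply: le_trans (normRe_le _) _.
  rewrite -(@ler_pXn2r _ 2)// ?nnegrE ?nrm_ge0// sqr_sqrtr ?subr_ge0//.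
  by have := STW x x1; have := qx x x1; lra.
split; first by exists K.
rewrite -lerBrDr -[leRHS]sqr_sqrtr ?subr_ge0//.
by rewrite ler_pXn2r ?nnegrE ?opnorm_ge0// opnorm_le.
Qed.

End operator_bounds.

(** * Real and imaginary parts of an operator *)

Section cartesian.
Context {R : realType} {H : hilbertType R}.
Context (A : {linear H -> H}) (Ab : bounded_op A).
Implicit Types (x y : H).

Lemma inner_adjointl x y : inner (adjoint A x) y = inner x (A y).
Proof. by rewrite innerC -adjointP// -innerC. Qed.

Lemma nrm_half : nrm (2^-1 : R[i]^o) = 2^-1.
Proof. by apply: complexI; rewrite -normr_nrm normfV normr_nat fmorphV/= rmorph_nat. Qed.

Lemma nrm_half_i : nrm ((2 * 'i%R)^-1 : R[i]^o) = 2^-1.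
Proof.
by apply: complexI; rewrite -normr_nrm normfV normrM normCi mulr1 normr_nat fmorphV/= rmorph_nat.
Qed.

Lemma re_op_inner x y : inner (re_op A x) y = 2^-1 * (inner (A x) y + inner x (A y)).
Proof. by rewrite /re_op innerZl innerDl inner_adjointl. Qed.

Lemma im_op_inner x y :
  inner (im_op A x) y = (2 * 'i%R)^-1 * (inner (A x) y - inner x (A y)).
Proof. by rewrite /im_op innerZl innerDl -scaleN1r innerZl inner_adjointl mulN1r. Qed.

Lemma re_op_sym x y : dotr (re_op A x) y = dotr x (re_op A y).
Proof.
rewrite /dotr [inner x _]innerC !re_op_inner rmorphM rmorphD/= -!innerC.
by rewrite fmorphV rmorph_nat addrC.
Qed.

(** Conjugation negates the factor [(2 * 'i)^-1] and exchanges the two terms of the difference, so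
    the signs cancel. *)
Lemma im_op_sym x y : dotr (im_op A x) y = dotr x (im_op A y).
Proof.
rewrite /dotr [inner x _]innerC !im_op_inner rmorphM rmorphB/= -!innerC.
rewrite fmorphV rmorphM/= conjCi rmorph_nat mulrN invrN.
by rewrite mulNr -mulrN opprB.
Qed.

(** The two inner products on the left are the real and imaginary parts of [inner (A x) x], because
    [inner x (A x)] is its conjugate. *)
Lemma sqr_nrm_inner_cartesian x :
  nrm (inner (re_op A x) x : R[i]^o) ^+ 2 + nrm (inner (im_op A x) x : R[i]^o) ^+ 2
  = nrm (inner (A x) x : R[i]^o) ^+ 2.
Proof.
rewrite re_op_inner im_op_inner !nrmZ nrm_half nrm_half_i (innerC x) !sqr_nrmc.
rewrite !exprMn !sqr_nrmc.
by case: (inner (A x) x) => a b /=; field.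
Qed.

Lemma sqr_nrm_cartesian x :
  nrm (re_op A x) ^+ 2 + nrm (im_op A x) ^+ 2
  = (nrm (A x) ^+ 2 + nrm (adjoint A x) ^+ 2) / 2.
Proof.
rewrite !nrmZ nrm_half nrm_half_i !exprMn -mulrDr parallelogram.
by field.
Qed.

End cartesian.

Theorem theorem3p1 (R : realType) (H : hilbertType R)
    (A B X Y : {linear H -> H})
    (hA : bounded_op A) (hB : bounded_op B)
    (hX : bounded_op X) (hY : bounded_op Y) :
  let w := @numerical_radius R H in
  let c := @crawford_number R H in
  let nu :=
    (c (re_op A) ^+ 2 + c (im_op A) ^+ 2) / 2
    + `| (opnorm (re_op A) ^+ 2 - opnorm (im_op A) ^+ 2) / 2
         + (c (im_op A) ^+ 2 - c (re_op A) ^+ 2) / 2 | in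
  let bound :=
    2 * Num.sqrt 2 * opnorm B * Num.max (opnorm X) (opnorm Y)
    * Num.sqrt (w A ^+ 2 - nu) in
  w (fun x => A (X (B x)) + B (Y (A x))) <= bound /\
  w (fun x => A (X (B x)) - B (Y (A x))) <= bound.
Proof.
move=> w c nu bound.
have wA x : nrm x = 1 -> nrm (inner (A x) x : R[i]^o) ^+ 2 <= w A ^+ 2.
  move=> x1; have wx := le_numerical_radius A x hA x1.
  by rewrite ler_pXn2r// ?nnegrE ?nrm_ge0//; apply: le_trans wx; exact: nrm_ge0.
have [rb rec] : bounded_op (re_op A) /\
    opnorm (re_op A) ^+ 2 + c (im_op A) ^+ 2 <= w A ^+ 2.
  apply: opnorm_crawford => [|x x1]; first exact: re_op_sym.
  by rewrite sqr_nrm_inner_cartesian// wA.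
have [ib imc] : bounded_op (im_op A) /\
    opnorm (im_op A) ^+ 2 + c (re_op A) ^+ 2 <= w A ^+ 2.
  apply: opnorm_crawford => [|x x1]; first exact: im_op_sym.
  by rewrite addrC sqr_nrm_inner_cartesian// wA.
have nuP : opnorm (re_op A) ^+ 2 + opnorm (im_op A) ^+ 2 <= 2 * (w A ^+ 2 - nu).
  rewrite /nu.
  move: (opnorm (re_op A) ^+ 2) (opnorm (im_op A) ^+ 2) (c (re_op A) ^+ 2)
    (c (im_op A) ^+ 2) (w A ^+ 2) rec imc => a b p q W h1 h2.
  (* The argument of the absolute value is half of [(a + q) - (b + p)]; its sign tells which of [h1]
     and [h2] is the binding bound. *)
  by case: (ger0P ((a - b) / 2 + (q - p) / 2)) => _; lra.
(* [Num.sqrt] is 0 on negative numbers, so squaring it back requires this. *)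
have D0 : 0 <= w A ^+ 2 - nu.
  by have := sqr_ge0 (opnorm (re_op A)); have := sqr_ge0 (opnorm (im_op A)); lra.
set mu := Num.max (opnorm X) (opnorm Y).
have mu0 : 0 <= mu by rewrite le_max opnorm_ge0.
have B0 : 0 <= opnorm B by exact: opnorm_ge0.
(* The constant arises from [(u + v) ^+ 2 <= 2 * (u ^+ 2 + v ^+ 2)]: the right side is four times
   the sum of the squared norms of the two parts at [x], hence at most [8 * (w A ^+ 2 - nu)]. *)
have AA x : nrm x = 1 ->
    nrm (A x) + nrm (adjoint A x) <= 2 * Num.sqrt 2 * Num.sqrt (w A ^+ 2 - nu).
  move=> x1; rewrite -(@ler_pXn2r _ 2)// ?nnegrE ?addr_ge0 ?mulr_ge0 ?sqrtr_ge0 ?nrm_ge0//.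
  rewrite !exprMn !sqr_sqrtr//.
  have rx : nrm (re_op A x) ^+ 2 <= opnorm (re_op A) ^+ 2.
    by rewrite ler_pXn2r ?nnegrE ?nrm_ge0 ?opnorm_ge0// nrm_le_opnorm ?x1.
  have ix : nrm (im_op A x) ^+ 2 <= opnorm (im_op A) ^+ 2.
    by rewrite ler_pXn2r ?nnegrE ?nrm_ge0 ?opnorm_ge0// nrm_le_opnorm ?x1.
  have := sqr_nrm_cartesian A x.
  have := sqr_ge0 (nrm (A x) - nrm (adjoint A x)).
  lra.
(* The outer [A] passes to the other argument as its adjoint. In the second product [A] acts first,
   so [nrm (A x)] remains instead. *)
have AXB x : nrm x = 1 ->
    nrm (inner (A (X (B x))) x : R[i]^o) <= opnorm B * mu * nrm (adjoint A x).
  move=> x1; rewrite adjointP//; apply: le_trans (normc_inner_le _ _) _.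
  rewrite ler_wpM2r ?nrm_ge0//; apply: le_trans (nrm_lin_le _ _ hX) _.
  rewrite mulrC ler_pM ?nrm_ge0 ?opnorm_ge0//; last by rewrite le_max lexx.
  by apply: nrm_le_opnorm; rewrite ?x1.
have BYA x : nrm x = 1 ->
    nrm (inner (B (Y (A x))) x : R[i]^o) <= opnorm B * mu * nrm (A x).
  move=> x1; apply: le_trans (normc_inner_le _ _) _; rewrite x1 mulr1 -mulrA.
  apply: le_trans (nrm_lin_le _ _ hB) _; rewrite ler_wpM2l//.
  apply: le_trans (nrm_lin_le _ _ hY) _; rewrite ler_wpM2r ?nrm_ge0//.
  by rewrite le_max lexx orbT.
have bound0 : 0 <= bound by rewrite !mulr_ge0 ?sqrtr_ge0.
have sum_le x : nrm x = 1 -> nrm (inner (A (X (B x))) x : R[i]^o) +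
    nrm (inner (B (Y (A x))) x : R[i]^o) <= bound.
  move=> x1; apply: le_trans (lerD (AXB x x1) (BYA x x1)) _.
  have -> : bound = opnorm B * mu * (2 * Num.sqrt 2 * Num.sqrt (w A ^+ 2 - nu)).
    by rewrite /bound -/mu; ring.
  by rewrite -mulrDr ler_wpM2l ?mulr_ge0// addrC AA.
(* The triangle inequality erases the sign, so one bound covers both cases. *)
split; apply: numerical_radius_le => // x x1; apply: le_trans (sum_le x x1).
  by rewrite innerDl; exact: nrmD.
by rewrite innerDl -scaleN1r innerZl mulN1r; exact: nrmB.
Qed.
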